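(* Let $n,d\ge 2$ and let $\mathcal{I}=(\mathcal{S},\mathcal{A})$ be a partial $2$-$(n^d,n,1)$-design such that, for every line $\ell$ and every point $P\notin\ell$, there are at most $\frac{n^d-1}{n-1}-n$ lines through $P$ that do not meet $\ell$. If at most one point of $\mathcal{I}$ has valency less than $\frac{n^d-1}{n-1}-1$, then $\mathcal{I}$ can be completed to a full $2$-$(n^d,n,1)$-design.
   Context: A $2$-$(v,k,1)$-design (respectively partial $2$-$(v,k,1)$-design) consists of a set $\mathcal{S}$ of $v$ points and a set $\mathcal{A}$ of $k$-element subsets of $\mathcal{S}$ (lines) such that every two distinct points lie in exactly (respectively at most) one line. A partial $2$-$(v,k,1)$-design $(\mathcal{S},\mathcal{A})$ can be completed to a full design if there is a $2$-$(v,k,1)$-design $(\mathcal{S},\mathcal{A}')$ with $\mathcal{A}\subseteq\mathcal{A}'$. The valency of a point is the number of lines containing it. *)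

(* Defs.v *)
From HB Require Import structures.
From mathcomp Require Import all_boot.
Set Implicit Arguments.
Unset Strict Implicit.
Unset Printing Implicit Defensive.

Section Designs.
Variable S : finType.
Implicit Types (A : {set {set S}}) (l : {set S}) (P Q : S).

Definition lines_through A P : {set {set S}} := [set l in A | P \in l].

Definition valency A P : nat := #|lines_through A P|.

Definition lines_through2 A P Q : {set {set S}} :=
  [set l in A | (P \in l) && (Q \in l)].

Definition lines_through_missing A P l : {set {set S}} :=
  [set m in lines_through A P | m :&: l == set0].

(* The point set is the whole of the finite type S; a design is then given by
   its set of lines. *)
Definition partial_design (v k : nat) A : Prop :=
  [/\ #|S| = v,
      forall l, l \in A -> #|l| = k
    & forall P Q, P != Q -> #|lines_through2 A P Q| <= 1].

Definition design (v k : nat) A : Prop :=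
  [/\ #|S| = v,
      forall l, l \in A -> #|l| = k
    & forall P Q, P != Q -> #|lines_through2 A P Q| = 1].

Definition completable (v k : nat) A : Prop :=
  exists2 A' : {set {set S}}, A \subset A' & design v k A'.

End Designs.

(* n - 1 divides n ^ d - 1, so the quotient is exact; for n, d >= 2 it is at
   least n + 1, so subtracting n or 1 from it never truncates. *)
Definition full_valency (n d : nat) : nat := (n ^ d - 1) %/ (n - 1).

(* Main.v *)
(* Call two points noncollinear if no line of A contains both, and let r be the
   full valency. A point P of valency r - 1 is noncollinear with exactly n - 1
   points, and by the hypothesis on missing lines each line off P contains at
   most one of them; so P together with these points is a set [P] of n pairwise
   noncollinear points. If X has valency r - 1 and [X] contains P, then [X] is
   included in [P], hence equal to it. Of two noncollinear points at least one
   has valency r - 1, so exactly one set [X] contains both, and adding all these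
   sets as new lines completes the design. *)
Require Import Defs.
From HB Require Import structures.
From mathcomp Require Import all_boot.
From mathcomp Require Import zify.
Set Implicit Arguments.
Unset Strict Implicit.
Unset Printing Implicit Defensive.

(** [P] is added explicitly because [lines_through2 A P P] consists of all lines through [P], so it
    is usually nonempty. *)
Definition noncollinear_with (S : finType) (A : {set {set S}}) (P : S) : {set S} :=
  P |: [set Q | lines_through2 A P Q == set0].

Lemma full_valencyE (n d : nat) : 2 <= n ->
  full_valency n d * (n - 1) = n ^ d - 1.
Proof.
move=> hn; rewrite /full_valency divnK // !subn1 predn_exp.
exact: dvdn_mulr.
Qed.

Lemma leq_full_valency (n d : nat) : 2 <= n -> 2 <= d -> n <= full_valency n d.
Proof.
move=> hn hd; rewrite -(@leq_pmul2r (n - 1)) ?subn_gt0 // full_valencyE //.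
have: n ^ 2 <= n ^ d by rewrite leq_exp2l.
by rewrite mulnBr muln1 -mulnn; lia.
Qed.

Section PartialDesign.
Variables (S : finType) (A : {set {set S}}) (v n : nat).
Hypothesis hA : partial_design v n A.
Implicit Types (P Q X : S) (l Y : {set S}).
Local Notation nc := (noncollinear_with A).

Lemma lines_through2C P Q : lines_through2 A P Q = lines_through2 A Q P.
Proof. by apply/setP=> l; rewrite !inE; case: (P \in l); case: (Q \in l). Qed.

Lemma noncollinearC P Q : (P \in nc Q) = (Q \in nc P).
Proof. by rewrite !inE eq_sym lines_through2C. Qed.

Lemma card_lines_through2 P Q : P != Q ->
  #|lines_through2 A P Q| = (Q \notin nc P).
Proof.
move=> PQ; have [_ _ /(_ P Q PQ)] := hA.
rewrite !inE eq_sym (negPf PQ) /= -cards_eq0.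
by case: #|_| => [|[]].
Qed.

(** Double counting of the pairs of a point [Q] of [Y] and a line through [P] and [Q]: a point
    collinear with [P] lies on exactly one such line, any other on none. *)
Lemma card_collinear P Y : P \notin Y ->
  #|Y :\: nc P| = \sum_(m in lines_through A P) #|m :&: Y|.
Proof.
move=> PY.
transitivity (\sum_(Q in Y) \sum_(m in lines_through A P) (Q \in m : nat)).
  rewrite -sum1_card [LHS](eq_bigl (fun Q => (Q \in Y) && (Q \notin nc P))).
    rewrite big_mkcondr /=; apply: eq_bigr => Q QY.
    have PQ : P != Q by apply: contraNneq PY => ->.
    rewrite -big_mkcondr /= sum1_card.
    transitivity (#|lines_through2 A P Q|).
      by rewrite card_lines_through2 //; case: (_ \notin _).
    by apply: eq_card => m; rewrite !inE -!topredE /= !inE andbA.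
  by move=> Q; rewrite in_setD andbC.
rewrite exchange_big; apply: eq_bigr => m _ /=.
by rewrite -big_mkcondr /= sum1_card; apply: eq_card => Q; rewrite !inE andbC.
Qed.

Lemma card_noncollinear P : #|nc P| + valency A P * (n - 1) = v.
Proof.
have [cS cl _] := hA.
have := @card_collinear P [set~ P]; rewrite !inE eqxx => /(_ isT).
have -> : [set~ P] :\: nc P = ~: nc P.
  by apply/setP=> Q; rewrite !inE; case: (Q == P); rewrite ?andbF ?andbT.
rewrite (eq_bigr (fun=> n - 1)) => [|m].
  by rewrite sum_nat_const => <-; rewrite cardsC.
rewrite inE => /andP[mA Pm].
by rewrite -setDE -(cl m mA) [in RHS](cardsD1 P) Pm addKn.
Qed.

(** A line through [P] that meets [l] does so in a point collinear with [P], and different lines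
    give different points because they already share [P]. *)
Lemma valency_leq_collinear P l : l \in A -> P \notin l ->
  valency A P <= #|lines_through_missing A P l| + #|l :\: nc P|.
Proof.
move=> lA Pl; rewrite card_collinear // /valency -!sum1_card.
rewrite [X in X + _](eq_bigl (fun m => (m \in lines_through A P) && (m :&: l == set0)));
  last by move=> m; rewrite inE.
rewrite big_mkcondr -big_split /=; apply: leq_sum => m _.
by rewrite -cards_eq0; case: #|_|.
Qed.

End PartialDesign.

Theorem lemma2 (n d : nat) (hn : 2 <= n) (hd : 2 <= d)
    (S : finType) (A : {set {set S}})
    (hA : partial_design (n ^ d) n A)
    (hmiss : forall (l : {set S}) (P : S), l \in A -> P \notin l ->
       #|lines_through_missing A P l| <= full_valency n d - n)
    (hval : #|[set P : S | valency A P < full_valency n d - 1]| <= 1) :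
  completable (n ^ d) n A.
Proof.
have [cS cl le1] := hA.
set r := full_valency n d in hmiss hval *.
have rE : r * (n - 1) = n ^ d - 1 by apply: full_valencyE.
have rn : n <= r by apply: leq_full_valency.
have v0 : 0 < n ^ d by rewrite expn_gt0; lia.
pose nc := noncollinear_with A.
(* Since [r * (n - 1) = n ^ d - 1], removing one line leaves [n ^ d - (r - 1) * (n - 1) = n]. *)
have cnc P : valency A P = r - 1 -> #|nc P| = n.
  by move=> vP; have := card_noncollinear hA P; rewrite vP mulnBl rE -/(nc P); nia.
(* A line [l] through [Q] and [R] would avoid [P], and at least [(r - 1) - (r - n) = n - 1] of its
   [n] points would be collinear with [P]. This leaves at most one point of [l] in [nc P], but [Q]
   and [R] are two. *)
have ncP P Q R : valency A P = r - 1 -> Q \in nc P -> R \in nc P -> R \in nc Q.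
  move=> vP QP RP; rewrite in_setU1; have [//|nRQ] := eqVneq R Q; rewrite inE /=.
  apply: contraT => /set0Pn[l]; rewrite inE => /and3P[lA Ql Rl].
  have Pl : P \notin l.
    apply/negP=> Pl.
    have notnc X : X \in l -> X \in nc P -> X = P.
      move=> Xl; rewrite !inE => /orP[/eqP//|/eqP/setP/(_ l)].
      by rewrite !inE lA Pl Xl.
    by rewrite (notnc Q) // (notnc R) // eqxx in nRQ.
  have := valency_leq_collinear hA lA Pl; have := hmiss l P lA Pl.
  rewrite vP -/(nc P) => h1 h2.
  have : #|[set Q; R]| <= #|l :&: nc P|.
    by apply/subset_leq_card/subsetP=> X /set2P[]->; apply/setIP.
  have := cardsID (nc P) l; rewrite cards2 eq_sym nRQ (cl l lA); lia.
have nceq X P : valency A X = r - 1 -> valency A P = r - 1 -> P \in nc X ->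
    nc X = nc P.
  move=> vX vP PX; apply/eqP; rewrite eqEcard !cnc // leqnn andbT.
  by apply/subsetP=> Q; apply: ncP vX PX.
(* Here [nc P] has at least two points, so [valency A P * (n - 1)] is at most [n ^ d - 2], which is
   less than [r * (n - 1)]. *)
have deficient P Q : P != Q -> Q \in nc P -> valency A P < r.
  move=> PQ QP; have := card_noncollinear hA P; rewrite -/(nc P) => h.
  have : #|[set P; Q]| <= #|nc P|.
    by apply/subset_leq_card/subsetP=> X /set2P[]-> //; rewrite setU11.
  rewrite cards2 PQ => h2; rewrite -(@ltn_pmul2r (n - 1)) ?rE; lia.
(* Both valencies are below [r], and by [hval] they are not both below [r - 1]. *)
have near P Q : P != Q -> Q \in nc P ->
    valency A P = r - 1 \/ valency A Q = r - 1.
  move=> PQ QP; have := deficient _ _ PQ QP.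
  have := deficient Q P; rewrite eq_sym [P \in nc Q]noncollinearC => /(_ PQ QP).
  move=> hQ hP; case: (ltnP (valency A P) (r - 1)) => hP'; last by left; lia.
  case: (ltnP (valency A Q) (r - 1)) => hQ'; last by right; lia.
  have : #|[set P; Q]| <= 1.
    apply: leq_trans hval; apply/subset_leq_card/subsetP=> X /set2P[]->;
    by rewrite inE.
  by rewrite cards2 PQ.
pose B := [set nc X | X in [set X | valency A X == r - 1]].
have inB l : reflect (exists2 X, valency A X = r - 1 & l = nc X) (l \in B).
  apply: (iffP imsetP) => -[X]; first by rewrite inE => /eqP ? ->; exists X.
  by move=> vX ->; exists X => //; rewrite inE vX.
have uniqB P l : valency A P = r - 1 -> l \in B -> P \in l -> l = nc P.
  by move=> vP /inB[X vX ->] PX; apply: nceq.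
exists (A :|: B); first exact: subsetUl.
split=> // [l|P Q PQ].
  by case/setUP=> [/cl //|/inB[X vX ->]]; apply: cnc.
have -> : lines_through2 (A :|: B) P Q = lines_through2 A P Q :|: lines_through2 B P Q.
  by apply/setP=> l; rewrite !inE andb_orl.
(* By [ncP] the points of a new line are pairwise noncollinear, so a pair joined in [A] lies on no
   new line. *)
have [QP|QP] := boolP (Q \in nc P); last first.
  have -> : lines_through2 B P Q = set0.
    apply/eqP; apply: contraT => /set0Pn[l]; rewrite inE => /and3P[/inB[X vX ->] PX QX].
    by rewrite (ncP _ _ _ vX PX QX) in QP.
  by rewrite setU0 (card_lines_through2 hA PQ) QP.
have -> : lines_through2 A P Q = set0.
  by apply/eqP; rewrite -cards_eq0 (card_lines_through2 hA PQ) QP.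
rewrite set0U.
(* The goal is symmetric in [P] and [Q], so [near] allows this choice; by [uniqB] only [nc P] can
   then join them. *)
wlog vP : P Q PQ QP / valency A P = r - 1.
  move=> th; have [/th|vQ] := near _ _ PQ QP; first exact.
  by rewrite lines_through2C th // 1?eq_sym // [_ \in nc Q]noncollinearC.
apply/eqP/cards1P; exists (nc P); apply/setP=> l; rewrite !inE.
apply/and3P/eqP=> [[lB Pl _]|->]; first exact: uniqB.
split=> //; last exact: setU11.
by apply/inB; exists P.
Qed.
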